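(* Let $L,K,M\ge 1$ be integers, let $\beta_{jkn}>0$ ($1\le j,n\le L$, $1\le k\le K$) be large scale fading coefficients, and let $p_{kn}>0$ and $q_{kn}>0$ be the training and transmit powers. Put $\boldsymbol\beta_{kn}=(\beta_{1kn},\ldots,\beta_{Lkn})^T$ and $\boldsymbol\Lambda_k=\mathrm{diag}(\lambda_{1k},\ldots,\lambda_{Lk})$ with $$\lambda_{jk}=\Bigl(1+\sum_{i=1}^L\beta_{jki}p_{ki}\Bigr)\Bigl(1+\sum_{n=1}^L\sum_{m=1}^K\beta_{jmn}q_{mn}\Bigr).$$ If matched filtering is used as the $M$-dimensional decoding in Large Scale Fading Decoding (LSFD), then for every user $k$ in every cell $l$, the (normalized) LSFD coefficient vector $$\hat{\mathbf a}_{kl,\mathrm{opt}}=\Bigl(\sum_{n=1,\,n\ne l}^L\boldsymbol\beta_{kn}\boldsymbol\beta_{kn}^{\mathsf H}p_{kn}q_{kn}M+\boldsymbol\Lambda_k\Bigr)^{-1}\boldsymbol\beta_{kl}$$ is optimal, i.e. it maximizes $\mathrm{SINR}_{kl}(\hat{\mathbf a}_{kl})$ over all nonzero $\hat{\mathbf a}_{kl}\in\mathbb C^L$, and the corresponding maximal value is $$\mathrm{SINR}_{kl,\mathrm{opt}}=\boldsymbol\beta_{kl}^{\mathsf H}\Bigl(\sum_{n=1,\,n\ne l}^L\boldsymbol\beta_{kn}\boldsymbol\beta_{kn}^{\mathsf H}p_{kn}q_{kn}M+\boldsymbol\Lambda_k\Bigr)^{-1}\boldsymbol\beta_{kl}\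;p_{kl}q_{kl}M.$$
   Context: There are $L$ cells, each with a base station having $M$ antennas and $K$ single-antenna users. $\beta_{jkn}$ is the large scale fading coefficient between user $k$ of cell $n$ and base station $j$; $p_{kn}$ is the training power and $q_{kn}$ the data transmit power of user $k$ of cell $n$. In LSFD, base station $j$ produces a first-stage estimate $\tilde s_{kj}$ of the uplink signal of its user $k$ (here by matched filtering with the MMSE channel estimate), and a controller forms $\hat s_{kl}=\sum_{j=1}^L a_{klj}^*\tilde s_{kj}$ with coefficients $a_{klj}\in\mathbb C$. Write $$\hat a_{klj}=\frac{\beta_{jkj}\sqrt{p_{kj}}}{1+\sum_{i=1}^L\beta_{jki}p_{ki}}\,a_{klj},\qquad \hat{\mathbf a}_{kl}=(\hat a_{kl1},\ldots,\hat a_{klL})^T.$$ With matched filtering, the achievable SINR of user $k$ in cell $l$ as a function of $\hat{\mathbf a}_{kl}\neq \mathbf 0$ is $$\mathrm{SINR}_{kl}(\hat{\mathbf a}_{kl})=\frac{\bigl|\sum_{j=1}^L\hat a_{klj}^*\beta_{jkl}\bigr|^2p_{kl}q_{kl}M}{\sum_{n=1,\,n\neq l}^L\bigl|\sum_{j=1}^L\hat a_{klj}^*\beta_{jkn}\bigr|^2p_{kn}q_{kn}M+\sum_{j=1}^L|\hat a_{klj}|^2\bigl(1+\sum_{i=1}^L\beta_{jki}p_{ki}\bigr)\bigl(1+\sum_{n=1}^L\sum_{m=1}^K\beta_{jmn}q_{mn}\bigr)}.$$ $(\cdot)^{\mathsf H}$ denotes Hermitian transpose and $(\cdot)^*$ complex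 conjugation. *)

(* Defs.v *)
From mathcomp Require Import all_boot all_order all_algebra.
From mathcomp Require Import spectral reals complex.
Set Implicit Arguments.
Unset Strict Implicit.
Unset Printing Implicit Defensive.
Import GRing.Theory Num.Theory.
(* [ring_scope] is opened last so that [z^*] is [Num.conj z]. *)
Local Open Scope complex_scope.
Local Open Scope sesquilinear_scope.
Local Open Scope ring_scope.

(* [beta j k n] is the large scale fading coefficient between user [k] of cell
   [n] and base station [j]; [p k n] and [q k n] are the training and data
   powers of user [k] of cell [n]; [M] is the number of antennas. *)

Definition training_factor (R : realType) (L K : nat)
    (beta : 'I_L -> 'I_K -> 'I_L -> R) (p : 'I_K -> 'I_L -> R)
    (j : 'I_L) (k : 'I_K) : R :=
  1 + \sum_(i < L) beta j k i * p k i.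

Definition received_power (R : realType) (L K : nat)
    (beta : 'I_L -> 'I_K -> 'I_L -> R) (q : 'I_K -> 'I_L -> R)
    (j : 'I_L) : R :=
  1 + \sum_(n < L) \sum_(m < K) beta j m n * q m n.

Definition lsfd_gain (R : realType) (L K : nat)
    (beta : 'I_L -> 'I_K -> 'I_L -> R)
    (a : 'cV[R[i]]_L) (k : 'I_K) (n : 'I_L) : R[i] :=
  \sum_(j < L) (a j 0)^* * (beta j k n)%:C.

(* The achievable SINR of user [k] of cell [l] under matched filtering, as a
   function of the normalized coefficients
     hat a_{klj} = beta_{jkj} sqrt(p_{kj}) / (1 + \sum_i beta_{jki} p_{ki}) a_{klj}.
   [Normc.normc] is the real-valued modulus (the norm [`| |] of [R[i]] is itself
   [R[i]]-valued). *)
Definition sinr (R : realType) (L K M : nat)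
    (beta : 'I_L -> 'I_K -> 'I_L -> R) (p q : 'I_K -> 'I_L -> R)
    (k : 'I_K) (l : 'I_L) (a : 'cV[R[i]]_L) : R :=
  (Normc.normc (lsfd_gain beta a k l) ^+ 2 * p k l * q k l * M%:R) /
  (\sum_(n < L | n != l)
      Normc.normc (lsfd_gain beta a k n) ^+ 2 * p k n * q k n * M%:R
   + \sum_(j < L) Normc.normc (a j 0) ^+ 2
       * training_factor beta p j k * received_power beta q j).

Definition beta_vec (R : realType) (L K : nat)
    (beta : 'I_L -> 'I_K -> 'I_L -> R) (k : 'I_K) (n : 'I_L) : 'cV[R[i]]_L :=
  \col_(j < L) (beta j k n)%:C.

Definition Lambda (R : realType) (L K : nat)
    (beta : 'I_L -> 'I_K -> 'I_L -> R) (p q : 'I_K -> 'I_L -> R)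
    (k : 'I_K) : 'M[R[i]]_L :=
  diag_mx (\row_(j < L)
    (training_factor beta p j k * received_power beta q j)%:C).

Definition interference_mx (R : realType) (L K M : nat)
    (beta : 'I_L -> 'I_K -> 'I_L -> R) (p q : 'I_K -> 'I_L -> R)
    (k : 'I_K) (l : 'I_L) : 'M[R[i]]_L :=
  \sum_(n < L | n != l)
      (p k n * q k n * M%:R)%:C *: (beta_vec beta k n *m (beta_vec beta k n)^t*)
  + Lambda beta p q k.

(* [invmx] is the inverse only on invertible matrices. *)
Definition lsfd_opt (R : realType) (L K M : nat)
    (beta : 'I_L -> 'I_K -> 'I_L -> R) (p q : 'I_K -> 'I_L -> R)
    (k : 'I_K) (l : 'I_L) : 'cV[R[i]]_L :=
  invmx (interference_mx M beta p q k l) *m beta_vec beta k l.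

(* Main.v *)
Require Import Defs.
From mathcomp Require Import all_boot all_order all_algebra.
From mathcomp Require Import spectral reals complex.
Import Order.TTheory GRing.Theory Num.Theory.
Local Open Scope complex_scope.
Local Open Scope sesquilinear_scope.
Local Open Scope ring_scope.

(** Up to the constant factor [p k l * q k l * M], the SINR is a generalized Rayleigh quotient |a^H
    b|^2 / (a^H A a), where b is [beta_vec beta k l] and A is [interference_mx]
    ([mxform_interference]). A is Hermitian, and positive definite because the denominator of the
    SINR is positive for a nonzero ([sinr_denom_gt0]). With x = A^-1 b one has a^H b = a^H A x, so
    Cauchy-Schwarz for the form of A ([mxform_CauchySchwarz]) bounds the quotient by x^H A x = b^H
    A^-1 b, and a = x attains the bound ([rayleigh_quotient_max]). *)

Definition mxform {C : numClosedFieldType} {n : nat} (A : 'M[C]_n)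
    (u v : 'cV[C]_n) : C :=
  (u^t* *m A *m v) 0 0.

Lemma mxformBr {C : numClosedFieldType} {n : nat} (A : 'M[C]_n) u v w :
  mxform A u (v - w) = mxform A u v - mxform A u w.
Proof. by rewrite /mxform mulmxBr !mxE. Qed.

Lemma mxformZr {C : numClosedFieldType} {n : nat} (A : 'M[C]_n) c u v :
  mxform A u (c *: v) = c * mxform A u v.
Proof. by rewrite /mxform -scalemxAr mxE. Qed.

Lemma mxform0r {C : numClosedFieldType} {n : nat} (A : 'M[C]_n) u :
  mxform A u 0 = 0.
Proof. by rewrite /mxform mulmx0 mxE. Qed.

Lemma trmxCM {C : numClosedFieldType} {m n r : nat} (A : 'M[C]_(m, n))
    (B : 'M[C]_(n, r)) :
  (A *m B)^t* = B^t* *m A^t*.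
Proof. by rewrite trmx_mul map_mxM. Qed.

(** Replaces computations in the first argument by the linearity in the second, and shows that the
    diagonal values of the form are real. *)
Lemma mxformC {C : numClosedFieldType} {n : nat} (A : 'M[C]_n) u v :
  A^t* = A -> mxform A u v = (mxform A v u)^*.
Proof.
move=> hA; rewrite /mxform.
transitivity ((v^t* *m A *m u)^t* 0 0); last by rewrite !mxE.
by rewrite !trmxCM trmxCK hA mulmxA.
Qed.

Lemma posdef_unitmx {C : numClosedFieldType} {n : nat} (A : 'M[C]_n) :
  (forall v, v != 0 -> 0 < mxform A v v) -> A \in unitmx.
Proof.
(* A singular [A] kills a nonzero row [v] on the left, so the form vanishes at the column [v^t*]. *)
move=> posA; rewrite unitmxE unitfE; apply/det0P => -[v vN0 vA0].
have /posA : v^t* != 0.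
  by apply: contra_neq vN0 => v0; rewrite -[v]trmxCK v0 trmx0 map_mx0.
by rewrite /mxform trmxCK vA0 mul0mx mxE ltxx.
Qed.

(** Gram-Schmidt without division: w = t u - s v is orthogonal to v for the form, and its square is
    t times the difference of the two sides; positivity of t and of the form concludes. *)
Lemma mxform_CauchySchwarz {C : numClosedFieldType} {n : nat} (A : 'M[C]_n)
    u v :
  A^t* = A -> (forall w, w != 0 -> 0 < mxform A w w) ->
  `|mxform A u v| ^+ 2 <= mxform A u u * mxform A v v.
Proof.
move=> hA posA.
have [-> | vN0] := eqVneq v 0.
  by rewrite !mxform0r normr0 expr0n mulr0.
have vv_gt0 := posA v vN0; set t := mxform A v v in vv_gt0 *.
set s := mxform A v u.
pose w := t *: u - s *: v.
have vw0 : mxform A v w = 0 by rewrite mxformBr !mxformZr -/t -/s mulrC subrr.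
have wv0 : mxform A w v = 0 by rewrite mxformC // vw0 conjC0.
have uw : mxform A u w = t * mxform A u u - `|mxform A u v| ^+ 2.
  by rewrite mxformBr !mxformZr normCK (mxformC A u v hA) -/s conjCK [s * _]mulrC.
have ww : mxform A w w = t * mxform A u w.
  rewrite {2}/w mxformBr !mxformZr wv0 mulr0 subr0 (mxformC A w u hA).
  (* Expanding the second [w] leaves the conjugate of [mxform A u w]; reality removes the
     conjugation. *)
  have : mxform A u w \is Num.real.
    rewrite uw; apply: rpredB; last by rewrite rpredX ?normr_real.
    by apply: rpredM; [exact: gtr0_real | apply/CrealP; rewrite -mxformC].
  by move/CrealP => ->.
rewrite -subr_ge0 [_ * t]mulrC -uw -(pmulr_rge0 _ vv_gt0) -ww.
have [-> | /posA /ltW //] := eqVneq w 0.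
by rewrite mxform0r.
Qed.

(* With [x = A^-1 b], the numerator [|a^H b|^2] is [|a^H A x|^2], to which
   Cauchy-Schwarz for the form of [A] applies. *)
Lemma rayleigh_quotient_max {C : numClosedFieldType} {n : nat} (A : 'M[C]_n)
    (b : 'cV[C]_n) :
  A^t* = A -> (forall w, w != 0 -> 0 < mxform A w w) -> b != 0 ->
  let x := invmx A *m b in
  let quotient a := `|(a^t* *m b) 0 0| ^+ 2 / mxform A a a in
  [/\ x != 0, quotient x = (b^t* *m invmx A *m b) 0 0
    & forall a, a != 0 -> quotient a <= quotient x].
Proof.
move=> hA posA bN0 x quotient.
have Au : A \in unitmx by exact: posdef_unitmx.
have Ax : A *m x = b by rewrite mulKVmx.
have xN0 : x != 0 by apply: contra_neq bN0 => x0; rewrite -Ax x0 mulmx0.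
have ab a : (a^t* *m b) 0 0 = mxform A a x by rewrite /mxform -mulmxA Ax.
have xx_gt0 := posA x xN0.
have qx : quotient x = mxform A x x.
  by rewrite /quotient ab gtr0_norm // expr2 mulfK ?gt_eqF.
split=> // [|a aN0].
  (* x^H A x equals its own conjugate, that is (x^H b)^* = b^H x. *)
  rewrite qx mxformC // -ab; transitivity ((x^t* *m b)^t* 0 0).
    by rewrite !mxE.
  by rewrite trmxCM trmxCK mulmxA.
by rewrite qx /quotient ab ler_pdivrMr ?posA // mulrC mxform_CauchySchwarz.
Qed.

Lemma lsfd_gainE (R : realType) (L K : nat)
    (beta : 'I_L -> 'I_K -> 'I_L -> R) (a : 'cV[R[i]]_L) k n :
  lsfd_gain beta a k n = (a^t* *m beta_vec beta k n) 0 0.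
Proof. by rewrite mxE; apply: eq_bigr => j _; rewrite !mxE. Qed.

Lemma conj_realC (R : realType) (x : R) : (x%:C)^* = x%:C.
Proof. by apply/CrealP/complex_realP; exists x. Qed.

Lemma interference_mx_herm (R : realType) (L K M : nat)
    (beta : 'I_L -> 'I_K -> 'I_L -> R) (p q : 'I_K -> 'I_L -> R) k l :
  (interference_mx M beta p q k l)^t* = interference_mx M beta p q k l.
Proof.
apply/matrixP => i j; rewrite !mxE !summxE rmorphD rmorph_sum /=.
congr (_ + _).
  apply: eq_bigr => n _; rewrite !mxE !big_ord1 !mxE !rmorphM /= !conj_realC.
  by rewrite [in LHS](mulrC (beta j k n)%:C).
by rewrite rmorphMn /= conj_realC; case: (eqVneq i j) => [->|].
Qed.

(** Copies the denominator in [sinr] verbatim, so that the two agree by conversion. *)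
Definition sinr_denom {R : realType} {L K : nat} (M : nat)
    (beta : 'I_L -> 'I_K -> 'I_L -> R) (p q : 'I_K -> 'I_L -> R)
    (k : 'I_K) (l : 'I_L) (a : 'cV[R[i]]_L) : R :=
  \sum_(n < L | n != l)
      Normc.normc (lsfd_gain beta a k n) ^+ 2 * p k n * q k n * M%:R
   + \sum_(j < L) Normc.normc (a j 0) ^+ 2
       * training_factor beta p j k * received_power beta q j.

(** Each rank-one term contributes a^H b_n b_n^H a = |a^H b_n|^2, and the diagonal [Lambda]
    contributes the weighted sum of the |a_j|^2. *)
Lemma mxform_interference (R : realType) (L K M : nat)
    (beta : 'I_L -> 'I_K -> 'I_L -> R) (p q : 'I_K -> 'I_L -> R) k l a :
  mxform (interference_mx M beta p q k l) a a
  = (sinr_denom M beta p q k l a)%:C.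
Proof.
have normE (z : R[i]) : (Normc.normc z)%:C = `|z| by [].
rewrite /mxform /interference_mx mulmxDr mulmxDl mxE /sinr_denom rmorphD.
rewrite !rmorph_sum mulmx_sumr mulmx_suml summxE; congr (_ + _).
  apply: eq_bigr => n _; rewrite -scalemxAr -scalemxAl mxE.
  rewrite !mulmxA -(mulmxA (_ *m _)) mxE big_ord1 -lsfd_gainE.
  have -> : ((beta_vec beta k n)^t* *m a) 0 0 = (lsfd_gain beta a k n)^*.
    transitivity ((a^t* *m beta_vec beta k n)^t* 0 0).
      by rewrite trmxCM trmxCK.
    by rewrite lsfd_gainE !mxE.
  rewrite -normCK -normE -rmorphXn -rmorphM.
  by congr (_ _); rewrite mulrC !mulrA.
rewrite /Lambda mul_mx_diag mxE; apply: eq_bigr => j _.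
by rewrite !mxE mulrAC [_^* * _]mulrC -normCK -normE -rmorphXn -rmorphM !mulrA.
Qed.

(** The interference sum is nonnegative; in the second sum all weights are positive, so a nonzero
    coordinate of [a] gives a positive term. *)
Lemma sinr_denom_gt0 (R : realType) (L K M : nat)
    (beta : 'I_L -> 'I_K -> 'I_L -> R) (p q : 'I_K -> 'I_L -> R)
    (hbeta : forall j k n, 0 < beta j k n)
    (hp : forall k n, 0 < p k n) (hq : forall k n, 0 < q k n) k l a :
  a != 0 -> 0 < sinr_denom M beta p q k l a.
Proof.
have normc_ge0 (z : R[i]) : 0 <= Normc.normc z ^+ 2 by exact: sqr_ge0.
have normc_gt0 (z : R[i]) : z != 0 -> 0 < Normc.normc z ^+ 2.
  move=> zN0; rewrite lt_def normc_ge0 andbT expf_neq0 //.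
  by apply: contra_neq zN0 => /Normc.eq0_normc.
move=> aN0; apply: ltr_wpDl.
  apply: sumr_ge0 => n _; apply: mulr_ge0; last exact: ler0n.
  by apply: mulr_ge0; [apply: mulr_ge0 | ]; rewrite // ltW.
have training_gt0 j : 0 < training_factor beta p j k.
  by rewrite ltr_pwDl // sumr_ge0 // => n _; rewrite ltW ?mulr_gt0.
have received_gt0 j : 0 < received_power beta q j.
  rewrite ltr_pwDl // sumr_ge0 // => n _.
  by rewrite sumr_ge0 // => m _; rewrite ltW ?mulr_gt0.
have term_ge0 j : 0 <= Normc.normc (a j 0) ^+ 2
    * training_factor beta p j k * received_power beta q j.
  by apply: mulr_ge0; [apply: mulr_ge0 | ]; rewrite // ltW.
have /cV0Pn[j ajN0] := aN0.
rewrite (bigD1 j) //= ltr_pwDl ?sumr_ge0 //.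
by apply: mulr_gt0 => //; apply: mulr_gt0 => //; exact: normc_gt0.
Qed.

Theorem theorem3 (R : realType) (L K M : nat)
    (hL : (1 <= L)%N) (hK : (1 <= K)%N) (hM : (1 <= M)%N)
    (beta : 'I_L -> 'I_K -> 'I_L -> R) (p q : 'I_K -> 'I_L -> R)
    (hbeta : forall j k n, 0 < beta j k n)
    (hp : forall k n, 0 < p k n) (hq : forall k n, 0 < q k n)
    (k : 'I_K) (l : 'I_L) :
  [/\ interference_mx M beta p q k l \in unitmx,
      lsfd_opt M beta p q k l != 0,
      forall a : 'cV[R[i]]_L, a != 0 ->
        sinr M beta p q k l a <= sinr M beta p q k l (lsfd_opt M beta p q k l)
    & (sinr M beta p q k l (lsfd_opt M beta p q k l))%:C =
      ((beta_vec beta k l)^t* *m invmx (interference_mx M beta p q k l)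
         *m beta_vec beta k l) 0 0 * (p k l * q k l * M%:R)%:C].
Proof.
set A := interference_mx M beta p q k l; set b := beta_vec beta k l.
have hA : A^t* = A by exact: interference_mx_herm.
have posA a : a != 0 -> 0 < mxform A a a.
  by move=> aN0; rewrite mxform_interference ltcR sinr_denom_gt0.
have bN0 : b != 0.
  (* The cell [l] also indexes a base station, and [beta l k l] is positive. *)
  by apply/cV0Pn; exists l; rewrite mxE fmorph_eq0 gt_eqF.
have sinrE a : (sinr M beta p q k l a)%:C
    = `|(a^t* *m b) 0 0| ^+ 2 / mxform A a a * (p k l * q k l * M%:R)%:C.
  have -> : `|(a^t* *m b) 0 0| ^+ 2 = (Normc.normc (lsfd_gain beta a k l) ^+ 2)%:C.
    by rewrite -lsfd_gainE rmorphXn.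
  rewrite mxform_interference -fmorph_div -rmorphM /=; congr (_%:C).
  by rewrite mulrAC !mulrA.
have [xN0 qx qmax] := rayleigh_quotient_max A b hA posA bN0.
split=> //; first exact: posdef_unitmx.
(* The real inequality is moved into [R[i]], where the quotients live; the common factor is
   nonnegative. *)
- move=> a aN0; rewrite -lecR !sinrE ler_wpM2r ?qmax //.
  by rewrite lecR !mulr_ge0 ?ler0n // ltW.
- by rewrite sinrE qx.
Qed.
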